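(* Let $X$ be a nonempty set and $Y$ a vector space. Let $f:X\to(-\infty,+\infty]$ and $g:Y\to(-\infty,+\infty]$ be proper functions, and let $\Phi$ and $\Psi$ be sets of functions $X\to\mathbb{R}$ and $Y\to\mathbb{R}$, respectively, with $0\in\Phi$ and $0\in\Psi$. Let $L:X\to Y$ be a mapping and assume $\operatorname{dom} g\cap L(\operatorname{dom} f)\neq\emptyset$. Consider the following conditions. (i) Every $(\phi,c_\phi)\in\operatorname{epi}(f+g\circ L)^*_\Phi$ can be expressed as $(\phi,c_\phi)=(\varphi+\psi\circ L,\;c_\varphi+c_\psi)$, where $(\varphi,c_\varphi)\in\operatorname{epi}f^*_\Phi$ and $(\psi,c_\psi)\in\operatorname{epi}g^*_\Psi$. (ii) For every $\phi\in\Phi$, $$(f+g\circ L)^*_\Phi(\phi)=\inf_{\psi\in\Psi}\{(f+\psi\circ L)^*_\Phi(\phi)+g^*_\Psi(\psi)\}$$ and the infimum is attained. Then (i) implies (ii). Moreover, if for every $\phi\in\Phi$ there is a solution $\bar\psi\in\Psi$ of the problem $\inf_{\psi\in\Psi}\{(f+\psi\circ L)^*_\Phi(\phi)+g^*_\Psi(\psi)\}$ such that $\phi+\bar\psi\circ L\in\Phi$ and $\phi-\bar\psi\circ L\in\Phi$, then (ii) implies (i).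
   Context: A function $h$ with values in $(-\infty,+\infty]$ is proper if $\operatorname{dom}h=\{x:h(x)<+\infty\}\neq\emptyset$. For $h:X\to(-\infty,+\infty]$ and $\phi\in\Phi$, $h^*_\Phi(\phi)=\sup_{x\in X}\{\phi(x)-h(x)\}$, and $\operatorname{epi}h^*_\Phi=\{(\phi,r)\in\Phi\times\mathbb{R}: h^*_\Phi(\phi)\le r\}$; similarly $g^*_\Psi(\psi)=\sup_{y\in Y}\{\psi(y)-g(y)\}$ for $\psi\in\Psi$ and $\operatorname{epi}g^*_\Psi=\{(\psi,r)\in\Psi\times\mathbb{R}: g^*_\Psi(\psi)\le r\}$. *)

(* Defs.v *)
From mathcomp Require Import all_boot all_order all_algebra.
From mathcomp Require Import all_classical all_reals ereal.

Set Implicit Arguments.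
Unset Strict Implicit.
Unset Printing Implicit Defensive.

Import Order.TTheory GRing.Theory Num.Theory.

Local Open Scope classical_set_scope.
Local Open Scope ring_scope.
Local Open Scope ereal_scope.

Section conjugate.
Variables (R : realType) (X : Type).
Implicit Types (h : X -> \bar R) (phi : X -> R) (Phi : set (X -> R)).

Definition edom h : set X := [set x | h x < +oo].

(* The first conjunct says that h takes its values in (-oo, +oo]. *)
Definition proper_fun h : Prop := (forall x, -oo < h x) /\ edom h !=set0.

(* The set Phi only restricts the arguments phi of the conjugate, so it does
   not appear here; it does in conjugate_epi. *)
Definition conjugate h phi : \bar R := ereal_sup (range (fun x => (phi x)%:E - h x)).

Definition conjugate_epi Phi h : set ((X -> R) * R) :=
  [set p | Phi p.1 /\ conjugate h p.1 <= p.2%:E].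

End conjugate.

Section duality.
Variables (R : realType) (X Y : Type).
Variables (f : X -> \bar R) (g : Y -> \bar R) (L : X -> Y).
Variables (Phi : set (X -> R)) (Psi : set (Y -> R)).

Definition epi_decomposition : Prop :=
  forall p, conjugate_epi Phi (f \+ (g \o L)) p ->
  exists p1 p2, [/\ conjugate_epi Phi f p1, conjugate_epi Psi g p2 &
    p = ((p1.1 \+ (p2.1 \o L))%R, (p1.2 + p2.2)%R)].

(* For proper f and g, neither summand is -oo. *)
Definition dual_objective (phi : X -> R) (psi : Y -> R) : \bar R :=
  conjugate (fun x => f x + (psi (L x))%:E) phi + conjugate g psi.

Definition dual_value (phi : X -> R) : \bar R :=
  ereal_inf (dual_objective phi @` Psi).

(* When the value of the problem is +oo, every element of Psi is a solution. *)
Definition dual_solution (phi : X -> R) (psi : Y -> R) : Prop :=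
  Psi psi /\ dual_objective phi psi = dual_value phi.

Definition exact_dual_formula : Prop :=
  forall phi, Phi phi ->
    conjugate (f \+ (g \o L)) phi = dual_value phi /\
    exists psi, dual_solution phi psi.

End duality.

(* Main.v *)
Require Import Defs.
From mathcomp Require Import all_boot all_order all_algebra.
From mathcomp Require Import all_classical all_reals ereal.
From mathcomp Require Import lra.

Set Implicit Arguments.
Unset Strict Implicit.
Unset Printing Implicit Defensive.

Import Order.TTheory GRing.Theory Num.Theory.

Local Open Scope classical_set_scope.
Local Open Scope ring_scope.

(* The tilt identity (f + psi o L)^*(phi) = f^*(phi - psi o L) turns the dual
   objective into f^*(phi - psi o L) + g^*(psi), which always bounds
   (f + g o L)^*(phi) from above. Its values at most c are therefore exactly
   the decompositions of (phi, c) with second component psi; since both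
   conjugates are > -oo, a finite bound on the sum splits into finite bounds on
   the summands. *)

Section conjugate_bounds.
Variables (R : realType) (X : Type).
Implicit Types (h : X -> \bar R) (phi psi : X -> R).

Lemma conjugate_ub h phi x : ((phi x)%:E - h x <= conjugate h phi)%E.
Proof. by apply: ereal_sup_ubound; exists x. Qed.

Lemma conjugate_le h phi (c : \bar R) :
  (forall x, ((phi x)%:E - h x <= c)%E) -> (conjugate h phi <= c)%E.
Proof. by move=> hc; apply: ge_ereal_sup => _ [x _ <-]. Qed.

Lemma conjugate_gtNy h phi : edom h !=set0 -> (-oo < conjugate h phi)%E.
Proof.
move=> [x hx]; apply: lt_le_trans (conjugate_ub h phi x).
by move: hx; rewrite /edom /=; case: (h x) => [r| |] // _; rewrite ?addey ?ltNyr ?ltNye.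
Qed.

Lemma conjugate_tilt h phi psi :
  conjugate (fun x => h x + (psi x)%:E)%E phi = conjugate h (phi \- psi).
Proof.
congr ereal_sup; congr image; apply/funext => x.
case: (h x) => [r| |] //=.
by congr EFin => /=; lra.
Qed.

End conjugate_bounds.

Section weak_duality.
Variables (R : realType) (X Y : Type).
Variables (f : X -> \bar R) (g : Y -> \bar R) (L : X -> Y).
Hypotheses (f_proper : proper_fun f) (g_proper : proper_fun g).

Lemma dual_objectiveE phi psi :
  dual_objective f g L phi psi =
  (conjugate f (phi \- (psi \o L))%R + conjugate g psi)%E.
Proof. by rewrite /dual_objective (conjugate_tilt f phi (psi \o L)). Qed.

(** Adding the bounds for [conjugate f] at [x] and for [conjugate g] at [L x] cancels the terms
    [psi (L x)]. *)
Lemma dual_objective_ge phi psi :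
  (conjugate (f \+ (g \o L))%E phi <= dual_objective f g L phi psi)%E.
Proof.
have [[fNy domf] [gNy domg]] := (f_proper, g_proper).
rewrite dual_objectiveE; apply: conjugate_le => x /=.
apply: le_trans (leeD (conjugate_ub f _ x) (conjugate_ub g psi (L x))).
move: (fNy x) (gNy (L x)).
case: (f x) => [r| |] //; case: (g (L x)) => [s| |] //= _ _.
by rewrite -!EFinD lee_fin; lra.
Qed.

Lemma dual_objective_le_split phi psi (c : R) :
  (dual_objective f g L phi psi <= c%:E)%E ->
  exists a b : R, [/\ (conjugate f (phi \- (psi \o L))%R <= a%:E)%E,
    (conjugate g psi <= b%:E)%E & c = a + b].
Proof.
have [[_ domf] [_ domg]] := (f_proper, g_proper).
rewrite dual_objectiveE.
(* In [\bar R], [+oo + -oo] is [-oo]: a bounded sum could hide a summand [+oo] if the other were not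
   known to exceed [-oo]. *)
move: (conjugate_gtNy (phi \- (psi \o L))%R domf) (conjugate_gtNy psi domg).
case: (conjugate f _) => [a| |] //; case: (conjugate g _) => [b| |] //= _ _.
(* All the slack goes into the first bound, so that the two sum to [c] exactly. *)
rewrite -EFinD lee_fin => abc; exists (c - b), b.
by rewrite !lee_fin lexx subrK lerBrDr.
Qed.

End weak_duality.

Theorem theorem5p2 (R : realType) (X : Type) (X_nonempty : inhabited X)
  (Y : lmodType R) (f : X -> \bar R) (g : Y -> \bar R)
  (f_proper : proper_fun f) (g_proper : proper_fun g)
  (Phi : set (X -> R)) (Psi : set (Y -> R))
  (Phi0 : Phi (fun=> 0)) (Psi0 : Psi (fun=> 0))
  (L : X -> Y) (domgLf : edom g `&` (L @` edom f) !=set0) :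
  (epi_decomposition f g L Phi Psi -> exact_dual_formula f g L Phi Psi) /\
  ((forall phi, Phi phi ->
      exists psi, [/\ dual_solution f g L Psi phi psi,
        Phi (phi \+ (psi \o L)) & Phi (phi \- (psi \o L))]) ->
   exact_dual_formula f g L Phi Psi -> epi_decomposition f g L Phi Psi).
Proof.
split=> [dec phi Phiphi|sol exact [phi c] [/= Phiphi phic]].
  have weak psi := dual_objective_ge L f_proper g_proper phi psi.
  have value_ge : (conjugate (f \+ (g \o L))%E phi <= dual_value f g L Psi phi)%E.
    by apply: le_ereal_inf_tmp => _ [psi _ <-]; exact: weak.
  (* By weak duality, one such [psi] gives both the equality and the attainment. *)
  suff [psi Psipsi le_psi] : exists2 psi, Psi psi &
      (dual_objective f g L phi psi <= conjugate (f \+ (g \o L))%E phi)%E.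
    have value_le : (dual_value f g L Psi phi <= dual_objective f g L phi psi)%E.
      by apply: ereal_inf_lbound; exists psi.
    have valueE : conjugate (f \+ (g \o L))%E phi = dual_value f g L Psi phi.
      by apply/eqP; rewrite eq_le value_ge (le_trans value_le le_psi).
    split=> //; exists psi; split=> //.
    by apply/eqP; rewrite eq_le value_le andbT -valueE.
  (* A common point of the domains keeps the conjugate above [-oo], leaving a real value or
     [+oo]. *)
  have dom_sum : edom (f \+ (g \o L))%E !=set0.
    have [y [gLx [x fx yE]]] := domgLf; subst y; exists x.
    exact: lte_add_pinfty.
  have := conjugate_gtNy phi dom_sum.
  case cE: (conjugate _ phi) => [c| |] // _; last first.
    by exists (fun=> 0); rewrite ?leey.
  (* Decompose the lowest point of the epigraph over [phi]: there [phi1] is [phi - psi o L], so the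
     objective at [psi] is at most [c1 + c2 = c]. *)
  have [|[phi1 c1] [[psi c2] [[/= _ le1] [/= Psipsi le2] [phiE c12]]]] :=
    dec (phi, c); first by split; rewrite /= ?cE.
  exists psi => //; rewrite dual_objectiveE c12 EFinD leeD //.
  suff -> : phi \- (psi \o L) = phi1 by [].
  by apply/funext => x /=; rewrite phiE /= addrK.
(* A solution [psi] attains the conjugate, so its objective is at most [c] and splits; [Phi_sub]
   puts [phi - psi o L] in [Phi], as the first epigraph requires. *)
have [psi [[Psipsi psiE] _ Phi_sub]] := sol phi Phiphi.
have [|a [b [fa gb cE]]] :=
    @dual_objective_le_split _ _ _ f g L f_proper g_proper phi psi c.
  by rewrite psiE -(exact phi Phiphi).1.
exists (phi \- (psi \o L), a), (psi, b); split=> //=.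
by rewrite cE; congr pair; apply/funext => x /=; rewrite subrK.
Qed.
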